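(* Suppose $\widetilde U=(\widetilde U_1,\widetilde U_2)$ and $\widehat U=(\widehat U_1,\widehat U_2)$ are ordered upper and lower solutions (nonincreasing case) of the scheme (NDS), and suppose that for every $m\ge1$, every $p\in\overline\Omega^h$, every $\alpha\neq\alpha'$ in $\{1,2\}$ and every $u\in\mathbb R^2$ with $\widehat U(p,t_m)\le u\le\widetilde U(p,t_m)$, $$\frac{\partial f_\alpha(p,t_m,u)}{\partial u_\alpha}\le c_\alpha(p,t_m),\qquad -\frac{\partial f_\alpha(p,t_m,u)}{\partial u_{\alpha'}}\le0,$$ where $c_\alpha$ are nonnegative bounded functions. Let $\{(\overline U^{(n)}_{1,i,m})_J,(\underline U^{(n)}_{2,i,m})_J\}$, $\{(\underline U^{(n)}_{1,i,m})_J,(\overline U^{(n)}_{2,i,m})_J\}$ and $\{(\overline U^{(n)}_{1,i,m})_{GS},(\underline U^{(n)}_{2,i,m})_{GS}\}$, $\{(\underline U^{(n)}_{1,i,m})_{GS},(\overline U^{(n)}_{2,i,m})_{GS}\}$ be the sequences generated, respectively, by the coupled block Jacobi method ($\eta=0$) and by the coupled block Gauss--Seidel method ($\eta=1$), with $(\overline U^{(0)})_J=(\overline U^{(0)})_{GS}=\widetilde U$ and $(\underline U^{(0)})_J=(\underline U^{(0)})_{GS}=\widehat U$. Then, for all $n$, $$(\underline U^{(n)}_{\alpha,i,m})_J\le(\underline U^{(n)}_{\alpha,i,m})_{GS}\le(\overline U^{(n)}_{\alpha,i,m})_{GS}\le(\overline U^{(n)}_{\alpha,i,m})_J,\qquad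 i=0,1,\dots,N_x,\ \alpha=1,2,\ m\ge1.$$
   Context: Data: $l_1,l_2,T>0$, $\omega=(0,l_1)\times(0,l_2)$, $Q_T=\omega\times(0,T]$, $\partial Q_T=\partial\omega\times(0,T]$; for $\alpha=1,2$: constants $\varepsilon_\alpha>0$, smooth functions $f_\alpha(x,y,t,u)$, $u=(u_1,u_2)$, $g_\alpha$ on $\partial Q_T$, $\psi_\alpha$ on $\overline\omega$, and smooth nonnegative $v_{\alpha,1},v_{\alpha,2}$ on $\overline Q_T$. Vector inequalities are componentwise; $\alpha'$ denotes the index in $\{1,2\}$ different from $\alpha$. Convention: $f_\alpha(p,t_m,a_\alpha,b_{\alpha'})$ is the value of $f_\alpha$ when $u_\alpha=a_\alpha$ and $u_{\alpha'}=b_{\alpha'}$. Mesh: $x_i=ih_x$ ($0\le i\le N_x$, $h_x=l_1/N_x$), $y_j=jh_y$ ($0\le j\le N_y$, $h_y=l_2/N_y$), $t_m=m\tau$ ($0\le m\le N_\tau$, $\tau=T/N_\tau$). $\overline\Omega^h$ is the set of all $p=(x_i,y_j)$, $\Omega^h$ the interior ones, $\partial\Omega^h=\overline\Omega^h\setminus\Omega^h$. ''$m\ge1$'' means $1\le m\le N_\tau$. Write $U_{\alpha,ij,m}=U_\alpha(x_i,y_j,t_m)$. Operator: $\mathcal L^h_\alpha U_\alpha=-\varepsilon_\alpha(D_x^2U_\alpha+D_y^2U_\alpha)+v_{\alpha,1}D_x^1U_\alpha+v_{\alpha,2}D_y^1U_\alpha$, with $D_x^2,D_y^2$ the standard second central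 differences and $D_x^1,D_y^1$ the backward differences, e.g. $D^1_xU_{\alpha,ij,m}=(U_{\alpha,ij,m}-U_{\alpha,i-1,j,m})/h_x$. Scheme (NDS): for $\alpha=1,2$, $m\ge1$, $(\mathcal L^h_\alpha(p,t_m)+\tau^{-1})U_\alpha(p,t_m)+f_\alpha(p,t_m,U)-\tau^{-1}U_\alpha(p,t_{m-1})=0$ for $p\in\Omega^h$; $U(p,t_m)=g(p,t_m)$ for $p\in\partial\Omega^h$; $U(p,0)=\psi(p)$ for $p\in\overline\Omega^h$. Ordered upper and lower solutions (nonincreasing case): $\widetilde U,\widehat U$ are such if, for all $m\ge1$ and $\alpha\ne\alpha'$: $\widetilde U\ge\widehat U$ on $\overline\Omega^h$; on $\Omega^h$, $(\mathcal L^h_\alpha+\tau^{-1})\widetilde U_\alpha(p,t_m)+f_\alpha(p,t_m,\widetilde U_\alpha,\widehat U_{\alpha'})-\tau^{-1}\widetilde U_\alpha(p,t_{m-1})\ge0$ and $(\mathcal L^h_\alpha+\tau^{-1})\widehat U_\alpha(p,t_m)+f_\alpha(p,t_m,\widehat U_\alpha,\widetilde U_{\alpha'})-\tau^{-1}\widehat U_\alpha(p,t_{m-1})\le0$; $\widehat U\le g\le\widetilde U$ on $\partial\Omega^h$; and $\widehat U(p,0)\le\psi(p)\le\widetilde U(p,0)$ on $\overline\Omega^h$. Block form: $l_{\alpha,ij,m}=\varepsilon_\alpha h_x^{-2}+v_{\alpha,1}(x_i,y_j,t_m)h_x^{-1}$, $r_{\alpha,ij,m}=\varepsilon_\alpha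 h_x^{-2}$, $b_{\alpha,ij,m}=\varepsilon_\alpha h_y^{-2}+v_{\alpha,2}(x_i,y_j,t_m)h_y^{-1}$, $t_{\alpha,ij,m}=\varepsilon_\alpha h_y^{-2}$, $d_{\alpha,ij,m}=\tau^{-1}+l_{\alpha,ij,m}+r_{\alpha,ij,m}+b_{\alpha,ij,m}+t_{\alpha,ij,m}$. Put $U_{\alpha,i,m}=(U_{\alpha,i,1,m},\dots,U_{\alpha,i,N_y-1,m})^T$ for $0\le i\le N_x$, and define $g_{\alpha,i,m}$ ($i=0,N_x$), $\psi_{\alpha,i}$ likewise. $L_{\alpha,i,m},R_{\alpha,i,m}$ are the diagonal matrices with entries $l_{\alpha,ij,m}$, $r_{\alpha,ij,m}$, $1\le j\le N_y-1$; $A_{\alpha,i,m}$ is the tridiagonal matrix with diagonal entries $d_{\alpha,ij,m}$, subdiagonal entries $-b_{\alpha,ij,m}$ and superdiagonal entries $-t_{\alpha,ij,m}$ in row $j$; $F_{\alpha,i,m}(U_{\alpha,i,m},U_{\alpha',i,m})$ is the vector with entries $f_\alpha(x_i,y_j,t_m,U_{\alpha,ij,m},U_{\alpha',ij,m})$ (the value of $f_\alpha$ at $(x_i,y_j,t_m)$ when $u_\alpha=U_{\alpha,ij,m}$ and $u_{\alpha'}=U_{\alpha',ij,m}$); $G^*_{\alpha,i,m}$ is the vector collecting the contributions of the boundary values at $j=0,N_y$: it has $-b_{\alpha,i1,m}g_\alpha(x_i,y_0,t_m)$ added in its first entry, $-t_{\alpha,i,N_y-1,m}g_\alpha(x_i,y_{N_y},t_m)$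 added in its last entry, and is zero otherwise. For $1\le i\le N_x-1$ the residual is $$\mathcal G_{\alpha,i,m}(U_{\alpha,i,m},U_{\alpha,i,m-1},U_{\alpha',i,m})=A_{\alpha,i,m}U_{\alpha,i,m}-L_{\alpha,i,m}U_{\alpha,i-1,m}-R_{\alpha,i,m}U_{\alpha,i+1,m}+F_{\alpha,i,m}(U_{\alpha,i,m},U_{\alpha',i,m})-\tau^{-1}U_{\alpha,i,m-1}+G^*_{\alpha,i,m}.$$ Coupled block iterative method with parameter $\eta\in\{0,1\}$: $c_{\alpha,m}=\max_{p\in\overline\Omega^h}c_\alpha(p,t_m)$. On each level $m\ge1$ and for $n\ge1$, $\overline U^{(n)}=\overline U^{(n-1)}+\overline Z^{(n)}$, $\underline U^{(n)}=\underline U^{(n-1)}+\underline Z^{(n)}$. The sequence $\{\overline U_1^{(n)},\underline U_2^{(n)}\}$ is given, for $1\le i\le N_x-1$, by $$A_{1,i,m}\overline Z^{(n)}_{1,i,m}-\eta L_{1,i,m}\overline Z^{(n)}_{1,i-1,m}+c_{1,m}\overline Z^{(n)}_{1,i,m}=-\mathcal G_{1,i,m}\big(\overline U^{(n-1)}_{1,i,m},\overline U_{1,i,m-1},\underline U^{(n-1)}_{2,i,m}\big),$$ $$A_{2,i,m}\underline Z^{(n)}_{2,i,m}-\eta L_{2,i,m}\underline Z^{(n)}_{2,i-1,m}+c_{2,m}\underline Z^{(n)}_{2,i,m}=-\mathcal G_{2,i,m}\big(\underline U^{(n-1)}_{2,i,m},\underline U_{2,i,m-1},\overline U^{(n-1)}_{1,i,m}\big),$$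 and $\{\underline U_1^{(n)},\overline U_2^{(n)}\}$ by the same formulas with overlines and underlines interchanged. For $i=0,N_x$: $Z^{(1)}_{\alpha,i,m}=g_{\alpha,i,m}-U^{(0)}_{\alpha,i,m}$, $Z^{(n)}_{\alpha,i,m}=\mathbf 0$ for $n\ge2$ (for each of the overlined and underlined quantities). On level $0$, $\overline U_{\alpha,i,0}=\underline U_{\alpha,i,0}=\psi_{\alpha,i}$; for $m\ge1$, $\overline U_{\alpha,i,m}=\overline U^{(n_m)}_{\alpha,i,m}$, $\underline U_{\alpha,i,m}=\underline U^{(n_m)}_{\alpha,i,m}$ are the approximate solutions on level $m$, $n_m\ge1$ being the number of iterations performed on level $m$; the numbers $n_m$ are the same for the Jacobi and the Gauss--Seidel sequences. *)

(* Defs.v *)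
From HB Require Import structures.
From mathcomp Require Import all_boot all_order all_algebra.
From mathcomp Require Import all_classical all_reals all_analysis.
Import Order.TTheory GRing.Theory Num.Theory.
Import numFieldNormedType.Exports.

Set Implicit Arguments.
Unset Strict Implicit.
Unset Printing Implicit Defensive.

Local Open Scope classical_set_scope.
Local Open Scope ring_scope.

Fixpoint Ck_on (R : realType) (n k : nat) (U : set 'rV[R]_n)
    (F : 'rV[R]_n -> R) : Prop :=
  (forall x, U x -> {for x, continuous F}) /\
  match k with
  | 0 => True
  | k'.+1 => forall i : 'I_n,
      (forall x, U x -> derivable F x 'e_i) /\
      Ck_on k' U (fun x => 'D_('e_i) F x)
  end.

(* On a set that need not be open, smooth means: near each point of the set,
   the restriction of a C^oo function defined on an open set. *)
Definition smooth_on (R : realType) (n : nat) (D : set 'rV[R]_n)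
    (F : 'rV[R]_n -> R) : Prop :=
  forall x, D x -> exists (U : set 'rV[R]_n) (G : 'rV[R]_n -> R),
    [/\ open U, U x, (forall k, Ck_on k U G) &
        forall y, U y -> D y -> F y = G y].

(* A space-time point (x, y, t) is a row vector of
   length 3, and (x, y) a row vector of length 2. *)

Definition omega_bar (R : realType) (l1 l2 : R) : set 'rV[R]_2 :=
  [set p | 0 <= p 0 0 <= l1 /\ 0 <= p 0 1 <= l2].

Definition Q_bar (R : realType) (l1 l2 T : R) : set 'rV[R]_3 :=
  [set q | [/\ 0 <= q 0 0 <= l1, 0 <= q 0 1 <= l2 & 0 <= q 0 2 <= T]].

(* the lateral boundary (boundary of omega) x (0, T] *)
Definition lateral (R : realType) (l1 l2 T : R) : set 'rV[R]_3 :=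
  [set q | [/\ 0 <= q 0 0 <= l1, 0 <= q 0 1 <= l2, 0 < q 0 2 <= T &
     [\/ q 0 0 = 0, q 0 0 = l1, q 0 1 = 0 | q 0 1 = l2]]].

(* The components alpha = 1, 2 are indexed by ord0, ord_max : 'I_2; likewise
   velocity a 0 = v_{a,1} and velocity a 1 = v_{a,2}. *)
Record problem (R : realType) := Problem {
  l1 : R;
  l2 : R;
  Tend : R;
  eps : 'I_2 -> R;
  f : 'I_2 -> 'rV[R]_3 -> 'rV[R]_2 -> R;
  g : 'I_2 -> 'rV[R]_3 -> R;
  psi : 'I_2 -> 'rV[R]_2 -> R;
  velocity : 'I_2 -> 'I_2 -> 'rV[R]_3 -> R;
  l1_gt0 : 0 < l1;
  l2_gt0 : 0 < l2;
  Tend_gt0 : 0 < Tend;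
  eps_gt0 : forall a, 0 < eps a;
  f_smooth : forall a, smooth_on
    [set w : 'rV[R]_(3 + 2) | Q_bar l1 l2 Tend (lsubmx w)]
    (fun w => f a (lsubmx w) (rsubmx w));
  g_smooth : forall a, smooth_on (lateral l1 l2 Tend) (g a);
  psi_smooth : forall a, smooth_on (omega_bar l1 l2) (psi a);
  velocity_smooth : forall a d, smooth_on (Q_bar l1 l2 Tend) (velocity a d);
  velocity_ge0 : forall a d q, Q_bar l1 l2 Tend q -> 0 <= velocity a d q
}.

Definition other (a : 'I_2) : 'I_2 := rev_ord a.

(* the vector u with u_a = s and u_{a'} = r *)
Definition upair (R : realType) (a : 'I_2) (s r : R) : 'rV[R]_2 :=
  \row_k (if k == a then s else r).

Record mesh := Mesh {
  Nx : nat;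
  Ny : nat;
  Nt : nat;
  Nx_gt0 : (0 < Nx)%N;
  Ny_gt0 : (0 < Ny)%N;
  Nt_gt0 : (0 < Nt)%N
}.

(* U i j m is the value at (x_i, y_j, t_m); only i <= Nx, j <= Ny, m <= Nt
   are meaningful. *)
Definition meshfun (R : realType) := nat -> nat -> nat -> R.

Section Scheme.
Variables (R : realType) (P : problem R) (M : mesh).

Definition hx : R := l1 P / (Nx M)%:R.
Definition hy : R := l2 P / (Ny M)%:R.
Definition tau : R := Tend P / (Nt M)%:R.

Definition node2 (i j : nat) : 'rV[R]_2 :=
  \row_k [:: i%:R * hx; j%:R * hy]`_k.
Definition node (i j m : nat) : 'rV[R]_3 :=
  \row_k [:: i%:R * hx; j%:R * hy; m%:R * tau]`_k.

Definition mesh_pt (i j : nat) : bool := (i <= Nx M)%N && (j <= Ny M)%N.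
Definition interior_pt (i j : nat) : bool :=
  (0 < i < Nx M)%N && (0 < j < Ny M)%N.
Definition boundary_pt (i j : nat) : bool :=
  mesh_pt i j && ~~ interior_pt i j.
Definition level (m : nat) : bool := (0 < m <= Nt M)%N.

Definition Dx2 (U : meshfun R) i j m : R :=
  (U i.-1 j m - 2 * U i j m + U i.+1 j m) / hx ^+ 2.
Definition Dy2 (U : meshfun R) i j m : R :=
  (U i j.-1 m - 2 * U i j m + U i j.+1 m) / hy ^+ 2.
Definition Dx1 (U : meshfun R) i j m : R := (U i j m - U i.-1 j m) / hx.
Definition Dy1 (U : meshfun R) i j m : R := (U i j m - U i j.-1 m) / hy.

Definition Lh (a : 'I_2) (U : meshfun R) i j m : R :=
  - eps P a * (Dx2 U i j m + Dy2 U i j m)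
  + velocity P a 0 (node i j m) * Dx1 U i j m
  + velocity P a 1 (node i j m) * Dy1 U i j m.

(* left-hand side of the scheme for component a, with V in the role of U_a
   and W in the role of U_{a'} *)
Definition nds_lhs (a : 'I_2) (V W : meshfun R) i j m : R :=
  Lh a V i j m + tau^-1 * V i j m
  + f P a (node i j m) (upair a (V i j m) (W i j m))
  - tau^-1 * V i j m.-1.

(* ordered upper (Ut) and lower (Uh) solutions, nonincreasing case *)
Record ordered_upper_lower (Ut Uh : 'I_2 -> meshfun R) : Prop := {
  oul_ordered : forall a i j m, level m -> mesh_pt i j ->
    Uh a i j m <= Ut a i j m;
  oul_upper : forall a i j m, level m -> interior_pt i j ->
    0 <= nds_lhs a (Ut a) (Uh (other a)) i j m;
  oul_lower : forall a i j m, level m -> interior_pt i j ->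
    nds_lhs a (Uh a) (Ut (other a)) i j m <= 0;
  oul_boundary : forall a i j m, level m -> boundary_pt i j ->
    Uh a i j m <= g P a (node i j m) <= Ut a i j m;
  oul_initial : forall a i j, mesh_pt i j ->
    Uh a i j 0%N <= psi P a (node2 i j) <= Ut a i j 0%N
}.

Definition nonneg_bounded (c : 'I_2 -> meshfun R) : Prop :=
  exists B : R, forall a i j m, level m -> mesh_pt i j ->
    0 <= c a i j m <= B.

Definition derivative_bounds (Ut Uh c : 'I_2 -> meshfun R) : Prop :=
  forall m i j a (u : 'rV[R]_2), level m -> mesh_pt i j ->
    (forall b, Uh b i j m <= u 0 b <= Ut b i j m) ->
    'D_('e_a) (f P a (node i j m)) u <= c a i j m /\
    - 'D_('e_(other a)) (f P a (node i j m)) u <= 0.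

(* Block vectors have entries j = 1, ..., Ny - 1; the row index
   k : 'I_(Ny - 1) stands for j = k + 1. *)

Definition block := 'cV[R]_((Ny M).-1).

Definition block_le (V W : block) : Prop := forall k, V k 0 <= W k 0.

Definition block_of (U : meshfun R) i m : block := \col_k U i k.+1 m.
Definition g_block a i m : block := \col_k g P a (node i k.+1 m).
Definition psi_block a i : block := \col_k psi P a (node2 i k.+1).

Definition lcoef a i j m : R :=
  eps P a / hx ^+ 2 + velocity P a 0 (node i j m) / hx.
Definition rcoef a (i j m : nat) : R := eps P a / hx ^+ 2.
Definition bcoef a i j m : R :=
  eps P a / hy ^+ 2 + velocity P a 1 (node i j m) / hy.
Definition tcoef a (i j m : nat) : R := eps P a / hy ^+ 2.
Definition dcoef a i j m : R :=
  tau^-1 + lcoef a i j m + rcoef a i j m + bcoef a i j m + tcoef a i j m.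

Definition Lmx a i m : 'M[R]_((Ny M).-1) :=
  diag_mx (\row_k lcoef a i k.+1 m).
Definition Rmx a i m : 'M[R]_((Ny M).-1) :=
  diag_mx (\row_k rcoef a i k.+1 m).
Definition Amx a i m : 'M[R]_((Ny M).-1) :=
  \matrix_(k, k') (if k' == k then dcoef a i k.+1 m
                   else if k'.+1 == k :> nat then - bcoef a i k.+1 m
                   else if k' == k.+1 :> nat then - tcoef a i k.+1 m
                   else 0).

Definition Fvec a i m (V W : block) : block :=
  \col_k f P a (node i k.+1 m) (upair a (V k 0) (W k 0)).

(* When Ny = 2 the first and the last entry coincide and both terms count. *)
Definition Gstar a i m : block :=
  \col_k ((if k == 0%N :> nat
           then - bcoef a i 1 m * g P a (node i 0 m) else 0)
        + (if k.+1 == (Ny M).-1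
           then - tcoef a i (Ny M).-1 m * g P a (node i (Ny M) m) else 0)).

(* The neighbouring blocks V (i - 1) and V (i + 1) also enter, so V is the
   whole family of blocks; Vold is the block i on level m - 1. *)
Definition residual a i m (V : nat -> block) (Vold W : block) : block :=
  Amx a i m *m V i - Lmx a i m *m V i.-1 - Rmx a i m *m V i.+1
  + Fvec a i m (V i) W - tau^-1 *: Vold + Gstar a i m.

Definition cmax (c : 'I_2 -> meshfun R) a m : R :=
  \big[Num.max/c a 0%N 0%N m]_(p : 'I_(Nx M).+1 * 'I_(Ny M).+1) c a p.1 p.2 m.

(* X a m n i is the block X^{(n)}_{a,i,m} *)
Definition iterates := 'I_2 -> nat -> nat -> nat -> block.

(* Z^{(n)} = X^{(n)} - X^{(n-1)}, for n >= 1 *)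
Definition increment (X : iterates) a m n i : block :=
  X a m n i - X a m n.-1 i.

(* approximate solution on level m, with nit m iterations on level m >= 1 *)
Definition level_solution (nit : nat -> nat) (X : iterates) a m i : block :=
  if m is 0%N then psi_block a i else X a m (nit m) i.

(* The equations for X_a, coupled to Y_{a'}, and the starting value X0_a *)
Definition half_method (eta : R) (c : 'I_2 -> meshfun R) (nit : nat -> nat)
    (X0 : 'I_2 -> meshfun R) (X Y : iterates) (a : 'I_2) : Prop :=
  [/\ forall m i, level m -> (i <= Nx M)%N ->
        X a m 0%N i = block_of (X0 a) i m,
      forall m n i, level m -> (1 <= n)%N -> (1 <= i <= (Nx M).-1)%N ->
        Amx a i m *m increment X a m n i
        - eta *: (Lmx a i m *m increment X a m n i.-1)
        + cmax c a m *: increment X a m n i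
        = - residual a i m (X a m n.-1) (level_solution nit X a m.-1 i)
              (Y (other a) m n.-1 i),
      forall m i, level m -> i = 0%N \/ i = Nx M ->
        increment X a m 1 i = g_block a i m - X a m 0%N i
    & forall m n i, level m -> (2 <= n)%N -> i = 0%N \/ i = Nx M ->
        increment X a m n i = 0].

(* Uov and Uun are the overlined and underlined iterates: the pairs
   (Uov_1, Uun_2) and (Uun_1, Uov_2) both satisfy the coupled equations. *)
Definition coupled_block_method (eta : R) (c : 'I_2 -> meshfun R)
    (nit : nat -> nat) (Ut Uh : 'I_2 -> meshfun R) (Uov Uun : iterates) : Prop :=
  forall a, half_method eta c nit Ut Uov Uun a /\
            half_method eta c nit Uh Uun Uov a.

End Scheme.

(* Main.v *)
Require Import Defs.
From mathcomp Require Import all_boot all_order all_algebra.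
From mathcomp Require Import all_classical all_reals all_analysis.
From mathcomp Require Import ring lra.
Import Order.TTheory GRing.Theory Num.Theory.
Import numFieldNormedType.Exports.

Set Implicit Arguments.
Unset Strict Implicit.
Unset Printing Implicit Defensive.

Local Open Scope classical_set_scope.
Local Open Scope ring_scope.

(** Fix a time level and a component a.  Splitting off the shift C = cmax c a m,
    one iteration solves, block after block,

      (A_i + C) X^(n)_i = C X^(n-1)_i - F (X^(n-1)_i, Y^(n-1)_i)
          + L_i S_(i-1) + R_i X^(n-1)_(i+1) + Old_i / tau - G*_i,

    where Y is the other component, Old the solution on the previous level, and
    S = eta X^(n) + (1 - eta) X^(n-1): the old neighbour for Jacobi, the freshly
    computed one for Gauss-Seidel ([half_method_sweep]).  The whole proof rests
    on the monotonicity of this equation.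

    - The right-hand side increases with X, S and Old and decreases with Y, as
      long as the arguments stay between the lower and the upper solution
      ([sweep_rhs_le]): L and R are nonnegative, and by the mean value theorem
      the bounds on the partial derivatives make C u - f increasing in its own
      component and decreasing in the other one ([f_mixed_le]).
    - A_i + C has nonpositive off-diagonal entries and positive row sums, so
      its inverse preserves the order ([monotone_matrix], [Amx_shift_le]).

    Induction on the block index i then turns ordered data into ordered results
    of a sweep ([sweep_le], [iterate_le]).  An upper solution is a supersolution
    of the sweep equation and a lower one a subsolution ([upper_sweep],
    [lower_sweep]), so that comparison starts both inductions on n: the
    upper iterates decrease, the lower ones increase and the two stay ordered
    ([squeezed_all]).  In particular they never leave the region where the
    derivative bounds hold.

    Finally, the Jacobi and Gauss-Seidel iterations solve the same equation
    except for S.  Where Jacobi uses the old upper iterate, Gauss-Seidel uses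
    the new one, which is smaller because the upper iterates decrease, so the
    Gauss-Seidel upper iterate is the smaller one; the lower iterates are
    reversed ([Jacobi_GaussSeidel]). *)

(** * Derivatives along lines and the reaction term *)

Lemma line_MVT (R : realType) (V : normedModType R) (F : V -> R) (p v : V)
    (s s' : R) :
  s <= s' -> (forall x, s <= x <= s' -> derivable F (p + x *: v) v) ->
  exists2 x, s <= x <= s' &
    F (p + s' *: v) - F (p + s *: v) = 'D_v F (p + x *: v) * (s' - s).
Proof.
move=> ss' dF; pose G (x : R) : R := F (p + x *: v).
(* The difference quotients of G and of F along v are the same functions, so
   derivability and derivative transfer without a chain rule. *)
have quotE x : (fun h : R => h^-1 *: (G (h *: 1 + x) - G x)) =
    (fun h => h^-1 *: (F (h *: v + (p + x *: v)) - F (p + x *: v))).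
  apply/funext => h; rewrite /G.
  by rewrite [h *: (1 : R)]mulr1 scalerDl addrCA.
have dG x : s <= x <= s' -> derivable G x 1.
  by move=> /dF; rewrite /derivable /= quotE.
have DG x : 'D_1 G x = 'D_v F (p + x *: v) by rewrite /derive /= quotE.
have [||x xin eqx] := @MVT_segment R G ('D_1 G) s s' ss' _ _.
- move=> x; rewrite in_itv /= => /andP[/ltW sx /ltW xs'].
  by apply/derivableP/dG; rewrite sx.
- by apply: derivable_within_continuous => x; rewrite in_itv; exact: dG.
by exists x; rewrite // -DG -eqx.
Qed.

(** The set on which smoothness is known need not be open, but a derivative
    in one of the unrestricted variables exists: moving along that direction
    stays in the set, where the function agrees with its smooth extension. *)
Lemma smooth_on_derivable_slice (R : realType) (n1 n2 : nat)
    (D : set 'rV[R]_n1) (h : 'rV[R]_n1 -> 'rV[R]_n2 -> R) (q : 'rV[R]_n1)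
    (u : 'rV[R]_n2) (b : 'I_n2) :
  smooth_on [set w : 'rV[R]_(n1 + n2) | D (lsubmx w)]
    (fun w => h (lsubmx w) (rsubmx w)) ->
  D q -> derivable (h q) u 'e_b.
Proof.
move=> smooth_h Dq.
have Dx : [set w : 'rV[R]_(n1 + n2) | D (lsubmx w)] (row_mx q u).
  by rewrite /= row_mxKl.
have [U [G [oU Ux CG hG]]] := smooth_h _ Dx.
have [_ /(_ (rshift n1 b))[/(_ _ Ux) dG _]] := CG 1%N.
have moveE (t : R) : t *: 'e_(rshift n1 b) + row_mx q u =
    row_mx q (t *: 'e_b + u) :> 'rV_(n1 + n2).
  rewrite -[X in X + _ = _](_ : row_mx 0 (t *: 'e_b) = _).
    by rewrite add_row_mx add0r.
  apply/rowP => k; rewrite !mxE.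
  rewrite !eqxx /= -(inj_eq val_inj k) /=.
  case: splitP => j kj; rewrite !mxE kj ?eqxx /=.
    by rewrite ltn_eqF ?mulr0// ltn_addr.
  by rewrite eqn_add2l.
have nearU : \forall t \near (0 : R)^', U (row_mx q (t *: 'e_b + u)).
  apply: nbhs_dnbhs.
  have cvgt : (t *: 'e_(rshift n1 b) + row_mx q u) @[t --> (0 : R)] -->
      0 *: 'e_(rshift n1 b) + row_mx q u.
    by apply: cvgD; [exact: scalel_continuous|exact: cvg_cst].
  rewrite scale0r add0r in cvgt.
  have : \forall t \near (0 : R), U (t *: 'e_(rshift n1 b) + row_mx q u).
    exact: cvgt _ (open_nbhs_nbhs (conj oU Ux)).
  by apply: filterS => t; rewrite moveE.
move: dG => /cvg_ex[l Gl]; apply/cvg_ex; exists l.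
apply: cvg_trans Gl; apply: near_eq_cvg; near=> t => /=.
have Ut : U (row_mx q (t *: 'e_b + u)) by near: t.
by rewrite moveE -!hG//= ?row_mxKl ?row_mxKr.
Unshelve. all: by end_near. Qed.

Lemma ord2_neq (a b : 'I_2) : (b != a) = (b == other a).
Proof. by case: a b => [[|[|?]] ?] [[|[|?]] ?]. Qed.

Lemma upair_other (R : realType) (a : 'I_2) (s r : R) :
  upair (other a) r s = upair a s r.
Proof.
by apply/rowP => k; rewrite !mxE -ord2_neq; case: eqP.
Qed.

(** Presents a variation of one component as motion along a coordinate line,
    the form in which the mean value theorem is available. *)
Lemma upair_line (R : realType) (a : 'I_2) (s r : R) :
  upair a s r = upair a 0 r + s *: 'e_a.
Proof.
apply/rowP => k; rewrite !mxE eqxx /=.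
by case: eqP; rewrite ?mulr1 ?mulr0 ?add0r ?addr0.
Qed.

Section Nodes.
Variables (R : realType) (P : problem R) (M : mesh).

Lemma hx_gt0 : 0 < hx P M.
Proof. by rewrite divr_gt0 ?l1_gt0 ?ltr0n ?Nx_gt0. Qed.

Lemma hy_gt0 : 0 < hy P M.
Proof. by rewrite divr_gt0 ?l2_gt0 ?ltr0n ?Ny_gt0. Qed.

Lemma tau_gt0 : 0 < tau P M.
Proof. by rewrite divr_gt0 ?Tend_gt0 ?ltr0n ?Nt_gt0. Qed.

Lemma node_Q_bar i j m : level M m -> mesh_pt M i j ->
  Q_bar (l1 P) (l2 P) (Tend P) (node P M i j m).
Proof.
have scaled (k n : nat) (l : R) : 0 < l -> (0 < n)%N -> (k <= n)%N ->
    0 <= k%:R * (l / n%:R) <= l.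
  move=> l_gt0 n_gt0 kn; apply/andP; split.
    by rewrite mulr_ge0 ?divr_ge0 ?ler0n// ltW.
  by rewrite mulrCA ger_pMr// ler_pdivrMr ?ltr0n// mul1r ler_nat.
move=> /andP[_ mNt] /andP[iNx jNy]; rewrite /Q_bar /= !mxE /=.
by split; apply: scaled;
  rewrite ?l1_gt0 ?l2_gt0 ?Tend_gt0 ?Nx_gt0 ?Ny_gt0 ?Nt_gt0.
Qed.

Lemma f_derivable a b i j m u : level M m -> mesh_pt M i j ->
  derivable (f P a (node P M i j m)) u 'e_b.
Proof.
move=> lm ij.
exact: smooth_on_derivable_slice (f_smooth (p := P) a) (node_Q_bar lm ij).
Qed.

(** The point moves first in the component a, where the slope is at most c,
    then in the other one, where f is nondecreasing; both segments stay in the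
    box in which the derivative bounds are assumed. *)
Lemma f_mixed_le (Ut Uh c : 'I_2 -> meshfun R) a i j m s s' r r' :
  derivative_bounds P M Ut Uh c -> level M m -> mesh_pt M i j ->
  Uh a i j m <= s -> s <= s' -> s' <= Ut a i j m ->
  Uh (other a) i j m <= r' -> r' <= r -> r <= Ut (other a) i j m ->
  f P a (node P M i j m) (upair a s' r')
    <= f P a (node P M i j m) (upair a s r) + c a i j m * (s' - s).
Proof.
move=> df lm ij hs ss' s't hr' r'r rt.
set F := f P a _.
have dF b u : derivable F u 'e_b by exact: f_derivable.
have [x /andP[sx xs'] xE] := @line_MVT _ _ F (upair a 0 r') 'e_a s s' ss'
  (fun x _ => dF a _).
have [y /andP[r'y yr] yE] := @line_MVT _ _ F (upair (other a) 0 s)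
  'e_(other a) r' r r'r (fun y _ => dF (other a) _).
rewrite -!upair_line in xE; rewrite -!upair_line !upair_other in yE.
have box s0 r0 : s <= s0 <= s' -> r' <= r0 <= r ->
    forall b, Uh b i j m <= upair a s0 r0 0 b <= Ut b i j m.
  move=> /andP[? ?] /andP[? ?] b; rewrite mxE; have [->|] := eqVneq b a.
    by apply/andP; split; lra.
  by rewrite ord2_neq => /eqP->; apply/andP; split; lra.
have sxs' : s <= x <= s' by rewrite sx.
have r'yr : r' <= y <= r by rewrite r'y.
have [dx _] := df m i j a (upair a x r') lm ij
  (box _ _ sxs' (introT andP (conj (lexx r') r'r))).
have [_ dy] := df m i j a (upair a s y) lm ij
  (box _ _ (introT andP (conj (lexx s) ss')) r'yr).
have : F (upair a s' r') - F (upair a s r') <= c a i j m * (s' - s).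
  by rewrite xE ler_wpM2r// subr_ge0.
have : 0 <= F (upair a s r) - F (upair a s r').
  by rewrite yE mulr_ge0 ?subr_ge0// -oppr_le0.
lra.
Qed.

Lemma le_cmax (c : 'I_2 -> meshfun R) a i j m :
  mesh_pt M i j -> c a i j m <= cmax M c a m.
Proof.
case/andP=> iNx jNy.
exact: (le_bigmax _ (fun p : 'I_(Nx M).+1 * 'I_(Ny M).+1 => c a p.1 p.2 m)
  (Ordinal (iNx : (i < (Nx M).+1)%N), Ordinal (jNy : (j < (Ny M).+1)%N))).
Qed.

End Nodes.

(** * Blocks, the monotone block matrices and the sweep equation *)

(** At an index k where v - w is largest, the off-diagonal signs give
    (B (v - w))_k >= (sum of row k) * (v - w)_k, which would be positive if
    (v - w)_k were. *)
Lemma monotone_matrix (R : realFieldType) (n : nat) (B : 'M[R]_n)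
    (v w : 'cV[R]_n) :
  (forall k k', k' != k -> B k k' <= 0) ->
  (forall k, 0 < \sum_k' B k k') ->
  (forall k, (B *m v) k 0 <= (B *m w) k 0) -> forall k, v k 0 <= w k 0.
Proof.
move=> offdiag_le0 rowsum_gt0 Bvw k0; rewrite -subr_le0.
have [k _ max_k] :=
  arg_maxP (fun k => v k 0 - w k 0) (erefl : xpredT k0).
apply: le_trans (max_k k0 _) _ => //; rewrite leNgt; apply/negP => vw_gt0.
have := Bvw k; rewrite leNgt => /negP; apply; rewrite -subr_gt0 !mxE -sumrB.
apply: lt_le_trans (mulr_gt0 (rowsum_gt0 k) vw_gt0) _.
rewrite mulr_suml; apply: ler_sum => k' _; rewrite -mulrBr.
have [->//|k'k] := eqVneq k' k.
by apply: ler_wnM2l; [exact: offdiag_le0|exact: max_k].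
Qed.

Lemma sum_ord_at (V : nmodType) (n j : nat) (F : nat -> V) :
  \sum_(k < n) (if k == j :> nat then F k else 0) =
  if (j < n)%N then F j else 0.
Proof.
rewrite -big_mkcond; case: ltnP => [jn|nj].
  by rewrite (big_pred1 (Ordinal jn)).
by rewrite big_pred0 // => k; rewrite ltn_eqF// (leq_trans (ltn_ord k)).
Qed.

Section Blocks.
Variables (R : realType) (P : problem R) (M : mesh).

Local Notation block := (block R M).

Lemma block_le_refl (V : block) : block_le V V.
Proof. by move=> k. Qed.

Lemma block_le_trans (W V X : block) :
  block_le V W -> block_le W X -> block_le V X.
Proof. by move=> VW WX k; exact: le_trans (VW k) (WX k). Qed.

Lemma mesh_pt_row i (k : 'I_(Ny M).-1) : (i <= Nx M)%N -> mesh_pt M i k.+1.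
Proof.
move=> iN; rewrite /mesh_pt iN /=.
by rewrite (leq_trans (ltn_ord k)) // leq_pred.
Qed.

Lemma interior_pt_row i (k : 'I_(Ny M).-1) :
  (0 < i < Nx M)%N -> interior_pt M i k.+1.
Proof.
by move=> iN; rewrite /interior_pt iN /= -ltn_predRL.
Qed.

Lemma rcoef_gt0 a i j m : 0 < rcoef P M a i j m.
Proof. by rewrite divr_gt0 ?eps_gt0 ?exprn_gt0 ?hx_gt0. Qed.

Lemma tcoef_gt0 a i j m : 0 < tcoef P M a i j m.
Proof. by rewrite divr_gt0 ?eps_gt0 ?exprn_gt0 ?hy_gt0. Qed.

Lemma lcoef_gt0 a i j m : level M m -> mesh_pt M i j -> 0 < lcoef P M a i j m.
Proof.
move=> lm ij; apply: ltr_wpDr (rcoef_gt0 a i j m).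
apply: divr_ge0; last by rewrite ltW ?hx_gt0.
by apply: velocity_ge0; exact: node_Q_bar.
Qed.

Lemma bcoef_gt0 a i j m : level M m -> mesh_pt M i j -> 0 < bcoef P M a i j m.
Proof.
move=> lm ij; apply: ltr_wpDr (tcoef_gt0 a i j m).
apply: divr_ge0; last by rewrite ltW ?hy_gt0.
by apply: velocity_ge0; exact: node_Q_bar.
Qed.

(** The product is written for a vector sampled from a function on all mesh
    indices: the two conditionals are the neighbours j = 0 and j = Ny, whose
    contribution the block form moves into Gstar. *)
Lemma mul_Amx a i m (u : nat -> R) (k : 'I_(Ny M).-1) :
  (Amx P M a i m *m \col_k' u k'.+1) k 0 =
  dcoef P M a i k.+1 m * u k.+1
  - bcoef P M a i k.+1 m * (if k == 0%N :> nat then 0 else u k)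
  - tcoef P M a i k.+1 m * (if k.+1 == (Ny M).-1 then 0 else u k.+2).
Proof.
rewrite mxE; set d := dcoef _ _ _ _ _ _; set b := bcoef _ _ _ _ _ _.
set t := tcoef _ _ _ _ _ _.
transitivity (\sum_(k' < (Ny M).-1) (if k' == k :> nat then d * u k'.+1 else 0)
  - \sum_(k' < (Ny M).-1) (if k' == k.-1 :> nat then
       b * (if k == 0%N :> nat then 0 else u k'.+1) else 0)
  - \sum_(k' < (Ny M).-1) (if k' == k.+1 :> nat then t * u k'.+1 else 0)).
  rewrite -!sumrB; apply: eq_bigr => k' _; rewrite !mxE -val_eqE /=.
  rewrite -/d -/b -/t; move: d b t; case: k => [k k_lt] /= d b t.
  have [->|k'k] := eqVneq (k' : nat) k.
    rewrite [k == k.+1]ltn_eqF// subr0; case: k k_lt => [|k] k_lt /=.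
      by rewrite mulr0 subr0.
    by rewrite gtn_eqF// subr0.
  case: k k_lt k'k => [|k] k_lt k'k /=.
    rewrite mulr0 if_same subr0 sub0r.
    by case: ifP => _; rewrite ?mulNr ?mul0r ?oppr0.
  rewrite eqSS; have [->|_] := eqVneq (k' : nat) k.
    by rewrite ltn_eqF// sub0r subr0 mulNr.
  by rewrite subr0 sub0r; case: ifP => _; rewrite ?mulNr ?mul0r ?oppr0.
rewrite (sum_ord_at _ _ (fun k' => d * u k'.+1)).
rewrite (sum_ord_at _ _
  (fun k' => b * (if k == 0%N :> nat then 0 else u k'.+1))).
rewrite (sum_ord_at _ _ (fun k' => t * u k'.+1)).
rewrite ltn_ord (leq_ltn_trans (leq_pred _) (ltn_ord k)).
congr (_ - b * _ - _); first by case: (val k).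
have := ltn_ord k; rewrite leq_eqVlt; case: eqP => /= [kn _|_ ->//].
by rewrite kn ltnn mulr0.
Qed.

Lemma Amx_shift_le a i m (C : R) (V W : block) :
  level M m -> (i <= Nx M)%N -> 0 <= C ->
  block_le (Amx P M a i m *m V + C *: V) (Amx P M a i m *m W + C *: W) ->
  block_le V W.
Proof.
move=> lm iN C_ge0; rewrite -!mul_scalar_mx -!mulmxDl.
apply: monotone_matrix => k.
  have [? ?] := (ltW (bcoef_gt0 a lm (mesh_pt_row k iN)),
                 ltW (tcoef_gt0 a i k.+1 m)).
  move=> k' k'k; rewrite !mxE (negbTE k'k) [k == k']eq_sym (negbTE k'k) addr0.
  by do 2![case: ifP => _; first by rewrite oppr_le0].
(* The row sums are the entries of the image of the constant vector 1. *)
have -> : \sum_k' (Amx P M a i m + C%:M) k k' =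
    (Amx P M a i m *m \col_k' (fun=> 1) k'.+1) k 0 + C.
  have sumC : \sum_(k' < (Ny M).-1) (if k' == k :> nat then C else 0) = C.
    by rewrite (sum_ord_at _ _ (fun=> C)) ltn_ord.
  rewrite mxE -[X in _ = _ + X]sumC -big_split; apply: eq_bigr => k' _.
  by rewrite !mxE mulr1; congr (_ + _); rewrite eq_sym -val_eqE /=; case: eqP.
rewrite (mul_Amx a i m (fun=> 1)) /dcoef.
have := tau_gt0 P M; rewrite -invr_gt0.
have := bcoef_gt0 a lm (mesh_pt_row k iN).
have := lcoef_gt0 a lm (mesh_pt_row k iN).
have := tcoef_gt0 a i k.+1 m; have := rcoef_gt0 a i k.+1 m.
by do 2!case: ifP => _; lra.
Qed.

(** The right-hand side of one step after the increments are eliminated; S is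
    the block i - 1 used in the step, Old the block i on the previous level. *)
Definition sweep_rhs a i m (C : R) (X Y : nat -> block) (S Old : block) :
    block :=
  C *: X i + Lmx P M a i m *m S + Rmx P M a i m *m X i.+1
  - Fvec P a i m (X i) (Y i) + (tau P M)^-1 *: Old - Gstar P M a i m.

Lemma sweep_rhsE a i m C X Y S Old (k : 'I_(Ny M).-1) :
  sweep_rhs a i m C X Y S Old k 0 =
  C * X i k 0 + lcoef P M a i k.+1 m * S k 0
  + rcoef P M a i k.+1 m * X i.+1 k 0
  - f P a (node P M i k.+1 m) (upair a (X i k 0) (Y i k 0))
  + (tau P M)^-1 * Old k 0 - Gstar P M a i m k 0.
Proof. by rewrite /sweep_rhs !mul_diag_mx !mxE. Qed.

(** Expanding the increments, A X^(n-1) cancels against the residual and L acts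
    on eta X^(n) + (1 - eta) X^(n-1). *)
Lemma half_method_sweep eta c nit X0 (X Y : iterates R M) a m n i :
  half_method P eta c nit X0 X Y a -> level M m -> (0 < i < Nx M)%N ->
  Amx P M a i m *m X a m n.+1 i + cmax M c a m *: X a m n.+1 i =
  sweep_rhs a i m (cmax M c a m) (X a m n) (Y (other a) m n)
    (eta *: X a m n.+1 i.-1 + (1 - eta) *: X a m n i.-1)
    (level_solution P nit X a m.-1 i).
Proof.
move=> [_ eqX _ _] lm iN.
have iN' : (1 <= i <= (Nx M).-1)%N.
  by case/andP: iN => -> iN /=; rewrite -ltnS prednK ?Nx_gt0.
have := eqX m n.+1 i lm isT iN'.
rewrite /increment /= mulmxBr => eqXn; apply/colP => k.
move/(congr1 (fun V : block => V k 0)): eqXn; rewrite sweep_rhsE.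
rewrite /residual /Lmx /Rmx !mul_diag_mx.
set An := Amx P M a i m *m X a m n.+1 i; set Ap := Amx P M a i m *m X a m n i.
rewrite !mxE => eqk; lra.
Qed.

(** After the first step the boundary blocks carry g whatever the starting
    value was, so they agree for all sequences. *)
Lemma half_method_boundary eta c nit X0 (X Y : iterates R M) a m n i :
  half_method P eta c nit X0 X Y a -> level M m -> i = 0%N \/ i = Nx M ->
  X a m n.+1 i = g_block P M a i m.
Proof.
move=> [_ _ X1 Xn] lm iN; elim: n => [|n IHn].
  by have := X1 m i lm iN; rewrite /increment /= => /subIr.
by have /eqP := Xn m n.+2 i lm isT iN; rewrite /increment /= subr_eq0 => /eqP->.
Qed.

(** Translates the pointwise inequalities of upper and lower solutions into
    block form.  The values of V itself appear at j = 0 and j = Ny, in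
    the place where the iteration uses g. *)
Lemma block_nds_lhs a (V W : meshfun R) i m (k : 'I_(Ny M).-1) :
  (Amx P M a i m *m block_of M V i m) k 0
  - (bcoef P M a i k.+1 m * (if k == 0%N :> nat then V i 0%N m else 0))
  - (tcoef P M a i k.+1 m * (if k.+1 == (Ny M).-1 then V i (Ny M) m else 0))
  - lcoef P M a i k.+1 m * V i.-1 k.+1 m
  - rcoef P M a i k.+1 m * V i.+1 k.+1 m
  + f P a (node P M i k.+1 m) (upair a (V i k.+1 m) (W i k.+1 m))
  - (tau P M)^-1 * V i k.+1 m.-1
  = nds_lhs P M a V W i k.+1 m.
Proof.
rewrite (mul_Amx _ _ _ (fun j => V i j m)) /nds_lhs /Lh /Dx2 /Dx1 /Dy2 /Dy1 /=.
set F := f _ _ _ _.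
have -> : (if k.+1 == (Ny M).-1 then V i (Ny M) m else 0) =
    V i k.+2 m - (if k.+1 == (Ny M).-1 then 0 else V i k.+2 m).
  case: eqP => [kN|_]; last by rewrite subrr.
  by rewrite subr0; congr V; rewrite kN prednK ?Ny_gt0.
have -> : (if k == 0%N :> nat then V i 0%N m else 0) =
    V i k m - (if k == 0%N :> nat then 0 else V i k m).
  by case: eqP => [->|_]; rewrite ?subrr ?subr0.
rewrite /dcoef /lcoef /rcoef /bcoef /tcoef.
set x := (hx P M)^-1; set y := (hy P M)^-1.
set x2 := (hx P M ^+ 2)^-1; set y2 := (hy P M ^+ 2)^-1.
set v := velocity P a 0 _; set w := velocity P a 1 _.
set V0 := if k == 0%N :> nat then 0 else _.
set V1 := if k.+1 == _ then 0 else _.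
ring.
Qed.

End Blocks.

(** * Comparison of sweeps *)

Section Comparison.
Variables (R : realType) (P : problem R) (M : mesh).
Variables (Ut Uh c : 'I_2 -> meshfun R).
Hypothesis oul : ordered_upper_lower P M Ut Uh.
Hypothesis c_bnd : nonneg_bounded M c.
Hypothesis df : derivative_bounds P M Ut Uh c.

Local Notation block := (block R M).
Local Notation blocks U m := (fun i => block_of M U i m).

(** Only the blocks 0, ..., Nx carry information: the methods leave the
    others arbitrary. *)
Definition family_le (V W : nat -> block) : Prop :=
  forall i, (i <= Nx M)%N -> block_le (V i) (W i).

Lemma family_le_refl V : family_le V V.
Proof. by move=> i _; exact: block_le_refl. Qed.

Lemma family_le_trans W V X : family_le V W -> family_le W X -> family_le V X.
Proof. by move=> VW WX i iN; exact: block_le_trans (VW i iN) (WX i iN). Qed.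

Lemma cmax_ge0 a m : level M m -> 0 <= cmax M c a m.
Proof.
have [B cB] := c_bnd; move=> lm; have pt00 : mesh_pt M 0 0 by [].
by have /andP[/le_trans-> //] := cB a 0%N 0%N m lm pt00; exact: le_cmax.
Qed.

Lemma add_scale_entry (V W : block) (C : R) k :
  (V + C *: W) k 0 = V k 0 + C * W k 0.
Proof. by rewrite !mxE. Qed.

Lemma interpolate_le (eta : R) (V V' W W' : block) : 0 <= eta <= 1 ->
  block_le V V' -> block_le W W' ->
  block_le (eta *: V + (1 - eta) *: W) (eta *: V' + (1 - eta) *: W').
Proof.
move=> /andP[eta_ge0 eta_le1] VV' WW' k; rewrite !mxE.
by apply: lerD; rewrite ler_wpM2l ?subr_ge0.
Qed.

Lemma interpolate_id (eta : R) (V : block) : eta *: V + (1 - eta) *: V = V.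
Proof. by rewrite -scalerDl addrC subrK scale1r. Qed.

Lemma sweep_rhs_le a i m (X X' Y Y' : nat -> block) (S S' Old Old' : block) :
  level M m -> (0 < i < Nx M)%N ->
  family_le (blocks (Uh a) m) X -> family_le X X' ->
  family_le X' (blocks (Ut a) m) ->
  family_le (blocks (Uh (other a)) m) Y' -> family_le Y' Y ->
  family_le Y (blocks (Ut (other a)) m) ->
  block_le S S' -> block_le Old Old' ->
  block_le (sweep_rhs P a i m (cmax M c a m) X Y S Old)
           (sweep_rhs P a i m (cmax M c a m) X' Y' S' Old').
Proof.
move=> lm /andP[i_gt0 iN] hX XX' X't hY' Y'Y Yt SS' OO' k.
have iN' := ltnW iN; have ij := mesh_pt_row k iN'.
have := (hX i iN' k, X't i iN' k, hY' i iN' k, Yt i iN' k).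
rewrite ![(block_of _ _ _ _) _ _]mxE => -[[[hXk X'tk] hY'k] Ytk].
rewrite !sweep_rhsE lerB// lerD ?ler_wpM2l ?invr_ge0 ?(ltW (tau_gt0 P M))//.
set C := cmax _ _ _ _.
have fle := f_mixed_le df lm ij hXk (XX' i iN' k) X'tk hY'k (Y'Y i iN' k) Ytk.
have Cle : c a i k.+1 m * (X' i k 0 - X i k 0) <= C * (X' i k 0 - X i k 0).
  by rewrite ler_wpM2r ?le_cmax// subr_ge0 XX'.
have Sle : lcoef P M a i k.+1 m * S k 0 <= lcoef P M a i k.+1 m * S' k 0.
  by rewrite ler_wpM2l// ltW// lcoef_gt0.
have Xle : rcoef P M a i k.+1 m * X i.+1 k 0 <=
           rcoef P M a i k.+1 m * X' i.+1 k 0.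
  by rewrite ler_wpM2l ?(ltW (rcoef_gt0 _ _ _ _ _ _))// XX'.
lra.
Qed.

(** A subsolution Z and a supersolution Z' of sweep equations with ordered data
    are ordered.  The block S_(i-1) may depend on Z_(i-1), so the order
    is propagated from block to block; the hypothesis on S and S' covers the
    Jacobi and Gauss-Seidel choices at once. *)
Lemma sweep_le a m (X X' Y Y' S S' Old Old' Z Z' : nat -> block) :
  level M m ->
  family_le (blocks (Uh a) m) X -> family_le X X' ->
  family_le X' (blocks (Ut a) m) ->
  family_le (blocks (Uh (other a)) m) Y' -> family_le Y' Y ->
  family_le Y (blocks (Ut (other a)) m) ->
  (forall i, (i <= Nx M)%N -> block_le (Z i) (Z' i) -> block_le (S i) (S' i)) ->
  (forall i, (0 < i < Nx M)%N -> block_le (Old i) (Old' i)) ->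
  (forall i, i = 0%N \/ i = Nx M -> block_le (Z i) (Z' i)) ->
  (forall i, (0 < i < Nx M)%N ->
    block_le (Amx P M a i m *m Z i + cmax M c a m *: Z i)
      (sweep_rhs P a i m (cmax M c a m) X Y (S i.-1) (Old i))) ->
  (forall i, (0 < i < Nx M)%N ->
    block_le (sweep_rhs P a i m (cmax M c a m) X' Y' (S' i.-1) (Old' i))
      (Amx P M a i m *m Z' i + cmax M c a m *: Z' i)) ->
  family_le Z Z'.
Proof.
move=> lm hX XX' X't hY' Y'Y Yt SS' OO' bZ eqZ eqZ'.
elim=> [|i IHi] iN; first by apply: bZ; left.
have [iN'|] := ltnP i.+1 (Nx M); last first.
  by move=> Ni; apply: bZ; right; apply/eqP; rewrite eqn_leq iN.
have i_in : (0 < i.+1 < Nx M)%N by [].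
apply: (Amx_shift_le lm iN (cmax_ge0 a lm)).
apply: block_le_trans (eqZ _ i_in) _.
apply: block_le_trans _ (eqZ' _ i_in).
apply: (sweep_rhs_le lm i_in hX XX' X't hY' Y'Y Yt); last exact: OO'.
by apply: SS'; [exact: ltnW|apply: IHi; exact: ltnW].
Qed.

(** The two sequences may have different parameters eta: this one comparison
    serves the monotonicity in n, the order between lower and upper
    iterates, and Jacobi against Gauss-Seidel.  Since a larger X goes with a
    smaller partner component, Y and Y' are ordered the other way. *)
Lemma iterate_le eta eta' nit nit' X0 X0' (X X' Y Y' : iterates R M) a m n n' :
  half_method P eta c nit X0 X Y a ->
  half_method P eta' c nit' X0' X' Y' a -> level M m ->
  family_le (blocks (Uh a) m) (X a m n) ->
  family_le (X a m n) (X' a m n') ->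
  family_le (X' a m n') (blocks (Ut a) m) ->
  family_le (blocks (Uh (other a)) m) (Y' (other a) m n') ->
  family_le (Y' (other a) m n') (Y (other a) m n) ->
  family_le (Y (other a) m n) (blocks (Ut (other a)) m) ->
  (forall i, (i <= Nx M)%N -> block_le (X a m n.+1 i) (X' a m n'.+1 i) ->
    block_le (eta *: X a m n.+1 i + (1 - eta) *: X a m n i)
             (eta' *: X' a m n'.+1 i + (1 - eta') *: X' a m n' i)) ->
  (forall i, (0 < i < Nx M)%N ->
    block_le (level_solution P nit X a m.-1 i)
             (level_solution P nit' X' a m.-1 i)) ->
  family_le (X a m n.+1) (X' a m n'.+1).
Proof.
move=> HX HX' lm hX XX' X't hY' Y'Y Yt SS' OO'.
apply: (sweep_le lm hX XX' X't hY' Y'Y Yt SS' OO') => i iN.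
- rewrite (half_method_boundary n HX lm iN).
  by rewrite (half_method_boundary n' HX' lm iN); exact: block_le_refl.
- by rewrite (half_method_sweep n HX lm iN); exact: block_le_refl.
- by rewrite (half_method_sweep n' HX' lm iN); exact: block_le_refl.
Qed.

(** * Upper and lower solutions in the sweep equation *)

Lemma Gstar_row a i m (k : 'I_(Ny M).-1) :
  Gstar P M a i m k 0 =
  - (bcoef P M a i k.+1 m *
      (if k == 0%N :> nat then g P a (node P M i 0 m) else 0))
  - (tcoef P M a i k.+1 m *
      (if k.+1 == (Ny M).-1 then g P a (node P M i (Ny M) m) else 0)).
Proof.
rewrite !mxE; congr (_ + _); case: eqP => [->|_];
  by rewrite ?mulr0 ?oppr0 ?mulNr.
Qed.

Lemma boundary_row i m a j : level M m -> (0 < i < Nx M)%N ->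
  j = 0%N \/ j = Ny M ->
  Uh a i j m <= g P a (node P M i j m) <= Ut a i j m.
Proof.
move=> lm /andP[_ iN] j0; apply: (oul_boundary oul) => //.
rewrite /boundary_pt /mesh_pt /interior_pt (ltnW iN) /=.
by case: j0 => ->; rewrite ?leqnn ?ltnn ?andbF.
Qed.

Lemma boundary_column i m a : level M m -> i = 0%N \/ i = Nx M ->
  block_le (block_of M (Uh a) i m) (g_block P M a i m) /\
  block_le (g_block P M a i m) (block_of M (Ut a) i m).
Proof.
move=> lm i0.
have bnd (k : 'I_(Ny M).-1) : boundary_pt M i k.+1.
  rewrite /boundary_pt mesh_pt_row; last by case: i0 => ->.
  by rewrite /interior_pt; case: i0 => ->; rewrite ?ltnn ?andbF.
by split=> k; rewrite !mxE; have /andP[] := oul_boundary oul a lm (bnd k).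
Qed.

(** Two slacks are absorbed here: the previous level is only below Ut, and the
    method replaces the values of Ut at j = 0 and j = Ny by the smaller g. *)
Lemma upper_sweep a i m Old : level M m -> (0 < i < Nx M)%N ->
  block_le Old (block_of M (Ut a) i m.-1) ->
  block_le (sweep_rhs P a i m (cmax M c a m) (blocks (Ut a) m)
              (blocks (Uh (other a)) m) (block_of M (Ut a) i.-1 m) Old)
    (Amx P M a i m *m block_of M (Ut a) i m
     + cmax M c a m *: block_of M (Ut a) i m).
Proof.
move=> lm iN Old_le k; rewrite sweep_rhsE Gstar_row.
have iN' : (i <= Nx M)%N by case/andP: iN => _ /ltnW.
have := oul_upper oul a lm (interior_pt_row k iN); rewrite -block_nds_lhs.
have /andP[_] := boundary_row a lm iN (or_introl (erefl 0%N)).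
have /andP[_] := boundary_row a lm iN (or_intror (erefl (Ny M))).
have := Old_le k.
have := ltW (tcoef_gt0 P M a i k.+1 m).
have := ltW (bcoef_gt0 P a lm (mesh_pt_row k iN')).
have : 0 <= (tau P M)^-1 by rewrite invr_ge0 ltW// tau_gt0.
rewrite add_scale_entry ![(block_of _ _ _ _) _ _]mxE.
move=> tau_ge0 b_ge0 t_ge0 /(ler_wpM2l tau_ge0) Ok gN g0.
have := ler_wpM2l t_ge0 gN; have := ler_wpM2l b_ge0 g0.
do 2!case: ifP => _; rewrite ?mulr0; lra.
Qed.

Lemma lower_sweep a i m Old : level M m -> (0 < i < Nx M)%N ->
  block_le (block_of M (Uh a) i m.-1) Old ->
  block_le (Amx P M a i m *m block_of M (Uh a) i m
            + cmax M c a m *: block_of M (Uh a) i m)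
    (sweep_rhs P a i m (cmax M c a m) (blocks (Uh a) m)
       (blocks (Ut (other a)) m) (block_of M (Uh a) i.-1 m) Old).
Proof.
move=> lm iN Old_le k; rewrite sweep_rhsE Gstar_row.
have iN' : (i <= Nx M)%N by case/andP: iN => _ /ltnW.
have := oul_lower oul a lm (interior_pt_row k iN); rewrite -block_nds_lhs.
have /andP[+ _] := boundary_row a lm iN (or_introl (erefl 0%N)).
have /andP[+ _] := boundary_row a lm iN (or_intror (erefl (Ny M))).
have := Old_le k.
have := ltW (tcoef_gt0 P M a i k.+1 m).
have := ltW (bcoef_gt0 P a lm (mesh_pt_row k iN')).
have : 0 <= (tau P M)^-1 by rewrite invr_ge0 ltW// tau_gt0.
rewrite add_scale_entry ![(block_of _ _ _ _) _ _]mxE.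
move=> tau_ge0 b_ge0 t_ge0 /(ler_wpM2l tau_ge0) Ok gN g0.
have := ler_wpM2l t_ge0 gN; have := ler_wpM2l b_ge0 g0.
do 2!case: ifP => _; rewrite ?mulr0; lra.
Qed.

(** * Monotone convergence pattern of one method *)

Record squeezed (Un Ov : iterates R M) a m n : Prop := {
  lower_start : family_le (blocks (Uh a) m) (Un a m n);
  lower_up : family_le (Un a m n) (Un a m n.+1);
  lower_upper : family_le (Un a m n.+1) (Ov a m n.+1);
  upper_down : family_le (Ov a m n.+1) (Ov a m n);
  upper_start : family_le (Ov a m n) (blocks (Ut a) m)
}.

Lemma squeezed_le Un Ov a m n :
  squeezed Un Ov a m n -> family_le (Un a m n) (Ov a m n).
Proof.
by case=> _ h1 h2 h3 _; apply: family_le_trans h1 (family_le_trans h2 h3).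
Qed.

(** What a level has to know of the previous one.  It is stated with
    [level_solution] so that it also makes sense for level 0, where both
    solutions are psi. *)
Definition old_squeezed nit (Un Ov : iterates R M) m := forall a i,
  (0 < i < Nx M)%N ->
  [/\ block_le (block_of M (Uh a) i m) (level_solution P nit Un a m i),
      block_le (level_solution P nit Un a m i) (level_solution P nit Ov a m i)
    & block_le (level_solution P nit Ov a m i) (block_of M (Ut a) i m)].

(** The starting value Ut solves no equation, hence it is compared with the
    first iterate as a supersolution of the sweep with the same data. *)
Lemma upper_first_le eta nit (X Y : iterates R M) a m : 0 <= eta <= 1 ->
  half_method P eta c nit Ut X Y a -> level M m ->
  family_le (blocks (Uh (other a)) m) (Y (other a) m 0%N) ->
  family_le (Y (other a) m 0%N) (blocks (Ut (other a)) m) ->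
  (forall i, (0 < i < Nx M)%N ->
    block_le (level_solution P nit X a m.-1 i) (block_of M (Ut a) i m.-1)) ->
  family_le (X a m 1%N) (X a m 0%N).
Proof.
move=> eta01 HX lm hY Yt Old_le.
have X0 i : (i <= Nx M)%N -> X a m 0%N i = block_of M (Ut a) i m.
  by move=> iN; case: HX => -> .
have X0t : family_le (X a m 0%N) (blocks (Ut a) m).
  by move=> i iN; rewrite X0//; exact: block_le_refl.
suff X1t : family_le (X a m 1%N) (blocks (Ut a) m).
  by move=> i iN; rewrite X0//; exact: X1t.
have hX0 : family_le (blocks (Uh a) m) (X a m 0%N).
  move=> i iN; rewrite X0// => k.
  by rewrite !mxE (oul_ordered oul)// mesh_pt_row.
apply: (@sweep_le a m (X a m 0%N) (blocks (Ut a) m) (Y (other a) m 0%N)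
  (blocks (Uh (other a)) m)
  (fun i => eta *: X a m 1%N i + (1 - eta) *: X a m 0%N i)
  (blocks (Ut a) m) (level_solution P nit X a m.-1)
  (level_solution P nit X a m.-1)) => // [||i iN X1i|i iN|i iN|i iN|i iN].
- exact: family_le_refl.
- exact: family_le_refl.
- rewrite -(interpolate_id eta (block_of M (Ut a) i m)).
  by apply: interpolate_le => //; exact: X0t.
- exact: block_le_refl.
- rewrite (half_method_boundary 0 HX lm iN).
  by have [] := boundary_column a lm iN.
- by rewrite (half_method_sweep 0 HX lm iN); exact: block_le_refl.
- by apply: upper_sweep => //; exact: Old_le.
Qed.

Lemma lower_first_le eta nit (X Y : iterates R M) a m : 0 <= eta <= 1 ->
  half_method P eta c nit Uh X Y a -> level M m ->
  family_le (blocks (Uh (other a)) m) (Y (other a) m 0%N) ->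
  family_le (Y (other a) m 0%N) (blocks (Ut (other a)) m) ->
  (forall i, (0 < i < Nx M)%N ->
    block_le (block_of M (Uh a) i m.-1) (level_solution P nit X a m.-1 i)) ->
  family_le (X a m 0%N) (X a m 1%N).
Proof.
move=> eta01 HX lm hY Yt Old_le.
have X0 i : (i <= Nx M)%N -> X a m 0%N i = block_of M (Uh a) i m.
  by move=> iN; case: HX => -> .
have hX0 : family_le (blocks (Uh a) m) (X a m 0%N).
  by move=> i iN; rewrite X0//; exact: block_le_refl.
suff hX1 : family_le (blocks (Uh a) m) (X a m 1%N).
  by move=> i iN; rewrite X0//; exact: hX1.
have X0t : family_le (X a m 0%N) (blocks (Ut a) m).
  move=> i iN; rewrite X0// => k.
  by rewrite !mxE (oul_ordered oul)// mesh_pt_row.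
apply: (@sweep_le a m (blocks (Uh a) m) (X a m 0%N) (blocks (Ut (other a)) m)
  (Y (other a) m 0%N) (blocks (Uh a) m)
  (fun i => eta *: X a m 1%N i + (1 - eta) *: X a m 0%N i)
  (level_solution P nit X a m.-1)
  (level_solution P nit X a m.-1)) => // [||i iN X1i|i iN|i iN|i iN|i iN].
- exact: family_le_refl.
- exact: family_le_refl.
- rewrite -[X in block_le X](interpolate_id eta (block_of M (Uh a) i m)).
  by apply: interpolate_le => //; exact: hX0.
- exact: block_le_refl.
- rewrite (half_method_boundary 0 HX lm iN).
  by have [] := boundary_column a lm iN.
- by apply: lower_sweep => //; exact: Old_le.
- by rewrite (half_method_sweep 0 HX lm iN); exact: block_le_refl.
Qed.

Lemma same_method_le eta nit X0 X0' (X X' Y Y' : iterates R M) a m n n' :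
  0 <= eta <= 1 ->
  half_method P eta c nit X0 X Y a ->
  half_method P eta c nit X0' X' Y' a -> level M m ->
  family_le (blocks (Uh a) m) (X a m n) ->
  family_le (X a m n) (X' a m n') ->
  family_le (X' a m n') (blocks (Ut a) m) ->
  family_le (blocks (Uh (other a)) m) (Y' (other a) m n') ->
  family_le (Y' (other a) m n') (Y (other a) m n) ->
  family_le (Y (other a) m n) (blocks (Ut (other a)) m) ->
  (forall i, (0 < i < Nx M)%N ->
    block_le (level_solution P nit X a m.-1 i)
             (level_solution P nit X' a m.-1 i)) ->
  family_le (X a m n.+1) (X' a m n'.+1).
Proof.
move=> eta01 HX HX' lm hX XX' X't hY' Y'Y Yt OO'.
apply: (iterate_le HX HX' lm hX XX' X't hY' Y'Y Yt _ OO') => i iN ZZ'.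
by apply: interpolate_le => //; exact: XX'.
Qed.

(** Each order at step n + 1 is the same comparison applied to an order at
    step n; the chain at step n also provides the bounds by Uh and Ut that
    this comparison needs. *)
Lemma squeezed_level eta nit Ov Un m : 0 <= eta <= 1 ->
  coupled_block_method P eta c nit Ut Uh Ov Un -> level M m ->
  old_squeezed nit Un Ov m.-1 -> forall n a, squeezed Un Ov a m n.
Proof.
move=> eta01 cbm lm old.
have HO a := (cbm a).1; have HU a := (cbm a).2.
have Un0 a i : (i <= Nx M)%N -> Un a m 0%N i = block_of M (Uh a) i m.
  by move=> iN; case: (HU a) => -> .
have Ov0 a i : (i <= Nx M)%N -> Ov a m 0%N i = block_of M (Ut a) i m.
  by move=> iN; case: (HO a) => -> .
have h0 a : family_le (blocks (Uh a) m) (Un a m 0%N).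
  by move=> i iN; rewrite Un0//; exact: block_le_refl.
have t0 a : family_le (Ov a m 0%N) (blocks (Ut a) m).
  by move=> i iN; rewrite Ov0//; exact: block_le_refl.
have Un0Ov0 a : family_le (Un a m 0%N) (Ov a m 0%N).
  move=> i iN k; rewrite Un0// Ov0// !mxE.
  by rewrite (oul_ordered oul)// mesh_pt_row.
elim=> [|n IHn] a.
  split=> //.
  - apply: (lower_first_le eta01 (HU a) lm) => //.
      exact: family_le_trans (h0 _) (Un0Ov0 _).
    by move=> i /(old a)[].
  - by apply: (same_method_le eta01 (HU a) (HO a) lm) => // i /(old a)[].
  - apply: (upper_first_le eta01 (HO a) lm) => //.
      exact: family_le_trans (Un0Ov0 _) (t0 _).
    by move=> i /(old a)[].
have [h1 h2 h3 h4 h5] := IHn a; have [k1 k2 k3 k4 k5] := IHn (other a).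
have h12 := family_le_trans h1 h2; have h45 := family_le_trans h4 h5.
have k12 := family_le_trans k1 k2; have k45 := family_le_trans k4 k5.
split=> //.
- apply: (same_method_le eta01 (HU a) (HU a) lm) => //.
  + exact: family_le_trans h3 h45.
  + exact: family_le_trans k12 k3.
  + by move=> i _; exact: block_le_refl.
- by apply: (same_method_le eta01 (HU a) (HO a) lm) => // i /(old a)[].
- apply: (same_method_le eta01 (HO a) (HO a) lm) => //.
  + exact: family_le_trans h12 h3.
  + exact: family_le_trans k3 k45.
  + by move=> i _; exact: block_le_refl.
Qed.

Lemma squeezed_all eta nit Ov Un m n a : 0 <= eta <= 1 ->
  coupled_block_method P eta c nit Ut Uh Ov Un -> level M m ->
  squeezed Un Ov a m n.
Proof.
move=> eta01 cbm; elim: m n a => [//|m IHm] n a lm.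
apply: (squeezed_level eta01 cbm lm) => /= b i iN.
have iN' : (i <= Nx M)%N by case/andP: iN => _ /ltnW.
case: m => [|m] in IHm lm *.
  by split=> k; rewrite ?lexx// !mxE; have /andP[] :=
    oul_initial oul b (mesh_pt_row k iN').
have lm' : level M m.+1 by case/andP: lm => _ /ltnW.
have sq := IHm (nit m.+1) b lm'.
split; first exact: lower_start sq i iN'.
  exact: squeezed_le sq i iN'.
exact: upper_start sq i iN'.
Qed.

(** * Jacobi against Gauss-Seidel *)

(** The orders are proved for both components and both bounds together, since
    a step of an upper iterate involves the lower iterate of the other
    component, and along the levels because the previous solutions enter. *)
Lemma Jacobi_GaussSeidel nit OvJ UnJ OvG UnG :
  coupled_block_method P 0 c nit Ut Uh OvJ UnJ ->
  coupled_block_method P 1 c nit Ut Uh OvG UnG ->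
  forall m n a, level M m ->
  family_le (UnJ a m n) (UnG a m n) /\ family_le (OvG a m n) (OvJ a m n).
Proof.
move=> cJ cG.
have sJ m n a := @squeezed_all 0 nit OvJ UnJ m n a
  (introT andP (conj (lexx 0) ler01)) cJ.
have sG m n a := @squeezed_all 1 nit OvG UnG m n a
  (introT andP (conj ler01 (lexx 1))) cG.
elim=> [//|m IHm] n a lm.
have old b i : (0 < i < Nx M)%N ->
    block_le (level_solution P nit UnJ b m i) (level_solution P nit UnG b m i)
    /\ block_le (level_solution P nit OvG b m i)
                (level_solution P nit OvJ b m i).
  move=> /andP[_ /ltnW iN].
  case: m => [|m] in IHm lm *; first by split; exact: block_le_refl.
  have lm' : level M m.+1 by case/andP: lm => _ /ltnW.
  by have [UU OO] := IHm (nit m.+1) b lm'; split; [exact: UU|exact: OO].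
elim: n a => [|n IHn] a.
  have [[J1 _ _ _] [J2 _ _ _]] := cJ a; have [[G1 _ _ _] [G2 _ _ _]] := cG a.
  by split=> i iN; rewrite ?J1 ?J2 ?G1 ?G2//; exact: block_le_refl.
have [UU OO] := IHn a; have [UU' OO'] := IHn (other a).
have [hJ _ _ _ Jt] := sJ _ n a lm; have [hJ' _ _ _ Jt'] := sJ _ n (other a) lm.
have [hG upG _ downG Gt] := sG _ n a lm.
have [hG' _ _ _ Gt'] := sG _ n (other a) lm.
have le_G := squeezed_le (sG _ n a lm).
have le_G' := squeezed_le (sG _ n (other a) lm).
split.
- apply: (iterate_le (cJ a).2 (cG a).2 lm hJ UU) => // [||i iN _|i iN].
  + exact: family_le_trans le_G Gt.
  + exact: family_le_trans hG' le_G'.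
  (* S is UnJ^(n) on the Jacobi side and UnG^(n+1) on the Gauss-Seidel side. *)
  + rewrite scale0r add0r subr0 subrr scale0r addr0 !scale1r.
    by apply: block_le_trans (UU i iN) _; exact: upG.
  + by have [] := old a i iN.
- apply: (iterate_le (cG a).1 (cJ a).1 lm _ OO) => // [||i iN _|i iN].
  + exact: family_le_trans hG le_G.
  + exact: family_le_trans le_G' Gt'.
  + rewrite scale0r add0r subr0 subrr scale0r addr0 !scale1r.
    by apply: block_le_trans _ (OO i iN); exact: downG.
  + by have [] := old a i iN.
Qed.

End Comparison.

Theorem theorem17 (R : realType) (P : problem R) (M : mesh)
    (Ut Uh c : 'I_2 -> meshfun R) (nit : nat -> nat)
    (UovJ UunJ UovGS UunGS : iterates R M) :
  ordered_upper_lower P M Ut Uh ->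
  nonneg_bounded M c ->
  derivative_bounds P M Ut Uh c ->
  (forall m, level M m -> (1 <= nit m)%N) ->
  coupled_block_method P 0 c nit Ut Uh UovJ UunJ ->
  coupled_block_method P 1 c nit Ut Uh UovGS UunGS ->
  forall (n i : nat) (a : 'I_2) (m : nat),
    (i <= Nx M)%N -> level M m ->
    [/\ block_le (UunJ a m n i) (UunGS a m n i),
        block_le (UunGS a m n i) (UovGS a m n i) &
        block_le (UovGS a m n i) (UovJ a m n i)].
Proof.
move=> oul c_bnd df _ cJ cG n i a m iN lm.
have [UU OO] := Jacobi_GaussSeidel oul c_bnd df cJ cG n a lm.
have eta01 : 0 <= (1 : R) <= 1 by rewrite ler01 lexx.
split; [exact: UU | | exact: OO].
exact: squeezed_le (squeezed_all oul c_bnd df n a eta01 cG lm) i iN.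
Qed.
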